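(* Let ${}_{i}^{\rho}\mathcal{V}_{\gamma,\beta,\alpha}^{\delta,p,q}f(t)$ and ${}_{i}^{\rho}\mathcal{V}_{\gamma,\beta,\mu}^{\delta,p,q}f(t)$ be the truncated $\mathcal{V}$-fractional derivatives of order $\alpha$ ($0<\alpha<1$) and $\mu$ ($0<\mu<1$), respectively. Then $${}_{i}^{\rho}\mathcal{V}_{\gamma,\beta,\alpha}^{\delta,p,q}\Big({}_{i}^{\rho}\mathcal{V}_{\gamma,\beta,\mu}^{\delta,p,q}f(t)\Big)=\frac{\Gamma(\beta)(\rho)_q}{\Gamma(\gamma+\beta)(\delta)_p}\Big((1-\mu)\big({}_{i}^{\rho}\mathcal{V}_{\gamma,\beta,\alpha+\mu}^{\delta,p,q}f(t)\big)+t\,\big({}_{i}^{\rho}\mathcal{V}_{\gamma,\beta,\alpha+\mu}^{\delta,p,q}f'(t)\big)\Big).$$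
   Context: Let $\gamma,\beta,\rho,\delta\in\mathbb{C}$ and $p,q>0$ be such that $\mathrm{Re}(\gamma)>0$, $\mathrm{Re}(\beta)>0$, $\mathrm{Re}(\rho)>0$, $\mathrm{Re}(\delta)>0$, $\mathrm{Re}(\gamma)+p\ge q$. Here $(\rho)_{s}=\Gamma(\rho+s)/\Gamma(\rho)$ and $(\delta)_{s}=\Gamma(\delta+s)/\Gamma(\delta)$ are (generalized) Pochhammer symbols. The truncated function, with the index $i$ being the upper limit of summation, is $${}_{i}H_{\gamma,\beta,p}^{\rho,\delta,q}(z):=\Gamma(\beta)\sum_{k=0}^{i}\frac{(\rho)_{qk}}{(\delta)_{pk}}\frac{z^k}{\Gamma(\gamma k+\beta)}.$$ For $f:[0,\infty)\to\mathbb{R}$ and $0<\alpha<1$, the truncated $\mathcal{V}$-fractional derivative of $f$ of order $\alpha$ is defined, for all $t>0$, by $${}_{i}^{\rho}\mathcal{V}_{\gamma,\beta,\alpha}^{\delta,p,q}f(t):=\lim_{\epsilon\to 0}\frac{f\big(t\,{}_{i}H_{\gamma,\beta,p}^{\rho,\delta,q}(\epsilon t^{-\alpha})\big)-f(t)}{\epsilon}.$$ The symbols with $\mu$ or $\alpha+\mu$ in place of $\alpha$ denote the same expression with the order replaced accordingly, and $f'$ is the ordinary derivative of $f$. *)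

(* Defs.v *)
From Stdlib Require Import Reals.
From Coquelicot Require Import Coquelicot.
Open Scope R_scope.

(* The complex power x^z of a positive real x: exp (z ln x). *)
Definition cpower (x : R) (z : C) : C :=
  (Rpower x (Re z) * cos (Im z * ln x), Rpower x (Re z) * sin (Im z * ln x)).

(* Euler's integral, which is the Gamma function on the half-plane Re z > 0;
   it is only ever evaluated there. *)
Definition Gamma (z : C) : C :=
  RInt_gen (V := C_R_CompleteNormedModule)
    (fun x : R => (cpower x (z - 1) * RtoC (exp (- x)))%C)
    (at_right 0) (Rbar_locally p_infty).

Definition poch (x : C) (s : R) : C := (Gamma (x + RtoC s) / Gamma x)%C.

(* [sum_n a i] is a 0 + ... + a i, with i + 1 terms. *)
Definition truncH (i : nat) (gamma beta rho delta : C) (p q : R) (z : C) : C :=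
  (Gamma beta *
   sum_n (fun k : nat =>
     poch rho (q * INR k) / poch delta (p * INR k)
     * (z ^ k / Gamma (gamma * RtoC (INR k) + beta))) i)%C.

Definition Varg (i : nat) (gamma beta rho delta : C) (p q alpha t eps : R) : C :=
  (RtoC t * truncH i gamma beta rho delta p q (RtoC (eps * Rpower t (- alpha))))%C.

Definition Vquot (i : nat) (gamma beta rho delta : C) (p q alpha : R)
    (f : R -> R) (t eps : R) : R :=
  (f (Re (Varg i gamma beta rho delta p q alpha t eps)) - f t) / eps.

(* The parameters are complex while f lives on [0,+oo), so f(t H(eps t^-alpha))
   has a meaning only when the argument is a nonnegative real; as for any limit,
   this is required for all small eps <> 0.  In particular a function
   f : R -> R is only ever evaluated on [0,+oo) here. *)
Definition ex_V (i : nat) (gamma beta rho delta : C) (p q alpha : R)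
    (f : R -> R) (t : R) : Prop :=
  locally' 0 (fun eps : R =>
    Im (Varg i gamma beta rho delta p q alpha t eps) = 0
    /\ 0 <= Re (Varg i gamma beta rho delta p q alpha t eps))
  /\ ex_finite_lim (Vquot i gamma beta rho delta p q alpha f t) 0.

(* Meaningful under [ex_V], like [Derive] under [ex_derive]. *)
Definition Vderiv (i : nat) (gamma beta rho delta : C) (p q alpha : R)
    (f : R -> R) (t : R) : R :=
  real (Lim (Vquot i gamma beta rho delta p q alpha f t) 0).

(* Main.v *)
Require Import Defs.
From Stdlib Require Import Reals Lra Lia.
From Coquelicot Require Import Coquelicot.
Open Scope R_scope.

(* The truncated series H is a polynomial with H(0) = 1, and existence of the derivatives of f
   forces its coefficients to be real.  If its linear coefficient c is nonzero, then
   e |-> t H(e t^-a) is a local homeomorphism at 0 with derivative c t^(1-a), so the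
   derivative of order a of g exists at t > 0 exactly when g'(t) does, and equals
   c t^(1-a) g'(t).  The formula is then the product rule for s |-> c s^(1-mu) f'(s).

   That H(0) = 1 and c <> 0 amounts to Gamma having no zero in Re z > 0.  By
   Gamma(z+1) = z Gamma(z) a zero at x + iy gives zeros at x + n + iy for all n; but for large x
   the Gamma density of shape x concentrates around x so much that
   Re (x^(-iy) Gamma(x+iy)) > 0. *)

(** * Gamma has no zero in the right half-plane *)

Definition improper_int (f : R -> R) (l : R) : Prop :=
  is_RInt_gen f (at_right 0) (Rbar_locally p_infty) l.

(** The cut at 1 separates the two endpoints, so that they are eventually positive and ordered and
    the [Rmin] and [Rmax] of the integration lemmas simplify. *)
Lemma pos_ends (P : R -> Prop) (Q : R -> Prop) :
  at_right 0 P -> Rbar_locally p_infty Q ->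
  filter_prod (at_right 0) (Rbar_locally p_infty)
    (fun ab => (0 < fst ab <= snd ab) /\ P (fst ab) /\ Q (snd ab)).
Proof.
intros HP HQ.
apply (Filter_prod _ _ _ (fun a => (0 < a < 1) /\ P a) (fun b => 1 < b /\ Q b)).
- apply filter_and; [|exact HP].
  apply filter_and.
  + exists (mkposreal _ Rlt_0_1). now intros.
  + exists (mkposreal _ Rlt_0_1). intros y Hy _.
    unfold ball in Hy; simpl in Hy; unfold AbsRing_ball, abs, minus, plus, opp in Hy;
    simpl in Hy. apply Rabs_def2 in Hy. lra.
- apply filter_and; [|exact HQ]. now exists 1.
- simpl. intros x y [Hx HPx] [Hy HQy]. repeat split; auto; lra.
Qed.

Lemma eventually_pos_interval (P : R * R -> Prop) :
  (forall a b, 0 < a <= b -> P (a, b)) ->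
  filter_prod (at_right 0) (Rbar_locally p_infty) P.
Proof.
intros H.
refine (filter_imp (fun ab : R * R => (0 < fst ab <= snd ab) /\ True /\ True) P _ _).
- intros [a b] [Hab _]. now apply H.
- apply (pos_ends (fun _ => True) (fun _ => True)); apply filter_true.
Qed.

Lemma improper_int_ext (f g : R -> R) (l l' : R) :
  (forall t, 0 < t -> f t = g t) -> l = l' -> improper_int f l -> improper_int g l'.
Proof.
intros H <- Hf.
refine (is_RInt_gen_ext f g l _ Hf).
apply eventually_pos_interval; simpl. intros a b Hab x.
rewrite Rmin_left by lra. intros Hx; apply H; lra.
Qed.

Lemma improper_int_lin (f g : R -> R) (u v lf lg : R) :
  improper_int f lf -> improper_int g lg ->
  improper_int (fun t => u * f t + v * g t) (u * lf + v * lg).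
Proof.
intros Hf Hg.
apply (is_RInt_gen_plus (fun t => u * f t) (fun t => v * g t)).
- now apply (is_RInt_gen_scal f).
- now apply (is_RInt_gen_scal g).
Qed.

Lemma improper_int_FTC (F f : R -> R) (l0 l1 : R) :
  (forall t, 0 < t -> is_derive F t (f t)) ->
  (forall t, 0 < t -> continuous f t) ->
  filterlim F (at_right 0) (locally l0) ->
  filterlim F (Rbar_locally p_infty) (locally l1) ->
  improper_int f (l1 - l0).
Proof.
intros HF Hf H0 H1.
apply (improper_int_ext (Derive F) _ (l1 - l0)).
{ intros t Ht. now apply is_derive_unique, HF. }
{ easy. }
apply (is_RInt_gen_Derive (Fa := at_right 0) (Fb := Rbar_locally p_infty) _ _);
  try assumption;
apply eventually_pos_interval; simpl; intros a b Hab x; rewrite Rmin_left by lra; intros Hx.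
- exists (f x). apply HF; lra.
- apply (continuous_ext_loc _ f).
  + exists (mkposreal x ltac:(lra)). intros y Hy.
    symmetry. apply is_derive_unique, HF.
    unfold ball in Hy; simpl in Hy; unfold AbsRing_ball, abs, minus, plus, opp in Hy;
    simpl in Hy. apply Rabs_def2 in Hy. lra.
  + apply Hf; lra.
Qed.

Lemma improper_int_le (f g : R -> R) (lf lg : R) :
  (forall t, 0 < t -> f t <= g t) ->
  improper_int f lf -> improper_int g lg -> lf <= lg.
Proof.
intros H Hf Hg.
assert (HD : improper_int (fun t => 1 * g t + -1 * f t) (1 * lg + -1 * lf))
  by now apply improper_int_lin.
assert (HD0 : improper_int (fun _ => 0) 0).
{ apply (improper_int_ext (fun t => 0 * f t + 0 * f t) _ (0 * lf + 0 * lf)).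
  - intros; ring.
  - ring.
  - now apply improper_int_lin. }
(* The zero function is dominated in norm by [g - f], so the norm of its integral is at most the
   integral of [g - f]. *)
enough (norm (0 : R_CompleteNormedModule) <= 1 * lg + -1 * lf) as HN.
{ generalize (norm_ge_0 (0 : R_CompleteNormedModule)). lra. }
refine (@RInt_gen_norm R_CompleteNormedModule _ _ _ _ _ _ _ _ _ _ HD0 HD);
apply eventually_pos_interval; simpl; intros a b Hab.
- lra.
- intros x Hx. unfold norm; simpl; unfold abs; simpl. rewrite Rabs_R0.
  specialize (H x). lra.
Qed.

(** The endpoints may come in either order: the Cauchy criterion compares two intervals whose
    endpoints are not ordered relative to each other. *)
Lemma abs_RInt_le_increment (F f g : R -> R) (u v : R) :
  (forall t, 0 < t -> is_derive F t (g t)) ->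
  (forall t, 0 < t -> continuous f t) ->
  (forall t, 0 < t -> continuous g t) ->
  (forall t, 0 < t -> Rabs (f t) <= g t) ->
  0 < u -> 0 < v -> Rabs (RInt f u v) <= Rabs (F v - F u).
Proof.
intros HF Hf Hg Hfg.
assert (Hle : forall a b, 0 < a -> a <= b -> Rabs (RInt f a b) <= Rabs (F b - F a)).
{ intros a b Ha Hab. apply Rle_trans with (F b - F a); [|apply Rle_abs].
  refine (norm_RInt_le (V := R_NormedModule) f g a b _ _ Hab _ _ _).
  - intros x Hx. apply Hfg; lra.
  - apply (RInt_correct (V := R_CompleteNormedModule)).
    apply (ex_RInt_continuous (V := R_CompleteNormedModule)).
    intros z. rewrite Rmin_left by lra. intros Hz; apply Hf; lra.
  - apply (is_RInt_derive (V := R_CompleteNormedModule) F g);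
    intros z; rewrite Rmin_left by lra; intros Hz; [apply HF|apply Hg]; lra. }
intros Hu Hv. destruct (Rle_lt_dec u v) as [Huv|Huv].
- now apply Hle.
- rewrite <- (opp_RInt_swap (V := R_CompleteNormedModule)).
  + unfold opp; simpl. rewrite Rabs_Ropp, Rabs_minus_sym. apply Hle; lra.
  + apply (ex_RInt_continuous (V := R_CompleteNormedModule)).
    intros z. rewrite Rmin_left by lra. intros Hz; apply Hf; lra.
Qed.

(** Cauchy criterion: moving the endpoints changes the integral of [f] by at most the increments of
    [F] at the two ends, and these are small because [F] has a finite limit at each end. *)
Lemma improper_int_dominated (F f g : R -> R) (l0 l1 : R) :
  (forall t, 0 < t -> is_derive F t (g t)) ->
  (forall t, 0 < t -> continuous f t) ->
  (forall t, 0 < t -> continuous g t) ->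
  (forall t, 0 < t -> Rabs (f t) <= g t) ->
  filterlim F (at_right 0) (locally l0) ->
  filterlim F (Rbar_locally p_infty) (locally l1) ->
  exists l, improper_int f l.
Proof.
intros HF Hf Hg Hfg H0 H1.
assert (Hex : forall a b, 0 < a -> 0 < b -> ex_RInt f a b).
{ intros a b Ha Hb. apply (ex_RInt_continuous (V := R_CompleteNormedModule)).
  intros z Hz. apply Hf. generalize (Rmin_glb_lt a b 0 Ha Hb). lra. }
destruct (proj1 (filterlim_locally_cauchy (U := R_CompleteSpace)
  (F := filter_prod (at_right 0) (Rbar_locally p_infty))
  (fun ab => RInt f (fst ab) (snd ab)))) as [l Hl].
- intros eps.
  assert (He : 0 < eps / 4) by (generalize (cond_pos eps); lra).
  exists (fun ab => (0 < fst ab <= snd ab) /\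
     Rabs (F (fst ab) - l0) < eps / 4 /\ Rabs (F (snd ab) - l1) < eps / 4).
  split.
  + apply (pos_ends (fun a => Rabs (F a - l0) < eps / 4) (fun b => Rabs (F b - l1) < eps / 4)).
    * apply (H0 (fun y => Rabs (y - l0) < eps / 4)). now exists (mkposreal _ He).
    * apply (H1 (fun y => Rabs (y - l1) < eps / 4)). now exists (mkposreal _ He).
  + intros [a b] [a' b']; simpl. intros (Hab & Ha & Hb) (Hab' & Ha' & Hb').
    assert (HR : RInt f a' b' - RInt f a b = RInt f a' a + RInt f b b').
    { rewrite <- (RInt_Chasles (V := R_CompleteNormedModule) f a' a b') by (apply Hex; lra).
      rewrite <- (RInt_Chasles (V := R_CompleteNormedModule) f a b b') by (apply Hex; lra).
      unfold plus; simpl; ring. }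
    change (Rabs (RInt f a' b' - RInt f a b) < eps). rewrite HR.
    apply Rle_lt_trans with (1 := Rabs_triang _ _).
    assert (K1 : Rabs (RInt f a' a) <= Rabs (F a - F a'))
      by (apply (abs_RInt_le_increment F f g); auto; lra).
    assert (K2 : Rabs (RInt f b b') <= Rabs (F b' - F b))
      by (apply (abs_RInt_le_increment F f g); auto; lra).
    apply Rabs_def2 in Ha, Hb, Ha', Hb'.
    assert (Rabs (F a - F a') < eps / 2) by (apply Rabs_def1; lra).
    assert (Rabs (F b' - F b) < eps / 2) by (apply Rabs_def1; lra).
    lra.
- exists l.
  apply (filterlimi_lim_ext_loc (fun ab => RInt f (fst ab) (snd ab))); [|exact Hl].
  apply eventually_pos_interval; simpl. intros a b Hab.
  apply (RInt_correct (V := R_CompleteNormedModule)). apply Hex; lra.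
Qed.

Lemma improper_int_pair (f : R -> C) (lr li : R) :
  improper_int (fun t => Re (f t)) lr -> improper_int (fun t => Im (f t)) li ->
  is_RInt_gen (V := C_R_CompleteNormedModule) f
    (at_right 0) (Rbar_locally p_infty) (lr, li).
Proof.
intros Hr Hi P [eps HP].
assert (H1 := Hr _ (locally_ball lr eps)).
assert (H2 := Hi _ (locally_ball li eps)).
unfold filtermapi in *.
generalize (filter_and _ _ H1 H2).
apply filter_imp. intros [a b]; simpl.
intros [(yr & Ir & Br) (yi & Ii & Bi)].
exists (yr, yi). split.
- now apply (is_RInt_fct_extend_pair (U := R_NormedModule) (V := R_NormedModule)).
- apply HP. now split.
Qed.

(* [Re (exp (I phi) t^(a - 1 + I b) exp (- t))]: the phase [phi] puts the real and imaginary
   parts of Euler's integrand in one family. *)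
Definition kernel (a b phi t : R) : R :=
  exp ((a - 1) * ln t - t) * cos (b * ln t + phi).

(** The logarithm lies below its tangent at [s]. In exponential form, [t^s <= exp t * (s / e)^s], an
    explicit bound of powers by exponentials. *)
Lemma mul_ln_le (s t : R) : 0 < s -> 0 < t -> s * ln t <= t + (s * ln s - s).
Proof.
intros Hs Ht.
replace t with (s * (t / s)) at 1 by (field; lra).
assert (0 < t / s) by now apply Rdiv_lt_0_compat.
rewrite ln_mult by assumption.
assert (ln (t / s) <= t / s - 1).
{ generalize (exp_ineq1_le (ln (t / s))). rewrite exp_ln by assumption. lra. }
replace (t + (s * ln s - s)) with (s * (ln s + (t / s - 1))) by (field; lra).
apply Rmult_le_compat_l; lra.
Qed.

Lemma filterlim_0_bound {T : Type} (F : (T -> Prop) -> Prop) {FF : Filter F}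
  (f g : T -> R) :
  F (fun x => Rabs (f x) <= g x) -> filterlim g F (locally 0) ->
  filterlim f F (locally 0).
Proof.
intros H Hg.
apply (filterlim_le_le (fun x => - g x) f g 0).
- apply filter_imp with (2 := H). intros x Hx. now apply Rabs_le_between.
- change (filterlim (fun x => - g x) F (locally 0)).
  apply filterlim_comp with (1 := Hg).
  rewrite <- Ropp_0 at 2. apply (filterlim_opp (V := R_NormedModule) 0).
- exact Hg.
Qed.

Lemma filterlim_exp_ln_0 (a : R) : 0 < a ->
  filterlim (fun t => exp (a * ln t)) (at_right 0) (locally 0).
Proof.
intros Ha.
apply filterlim_comp with (G := Rbar_locally m_infty); [|apply is_lim_exp_m].
apply filterlim_comp with (G := Rbar_locally m_infty); [apply is_lim_ln_0|].
intros P [M HM]. exists (M / a). intros x Hx. apply HM.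
apply (Rmult_lt_compat_l a) in Hx; [|exact Ha].
replace (a * (M / a)) with M in Hx by (field; lra). exact Hx.
Qed.

Lemma exp_le_compat (x y : R) : x <= y -> exp x <= exp y.
Proof. intros [H|H]; [now apply Rlt_le, exp_increasing|rewrite H; apply Rle_refl]. Qed.

Lemma at_right_0_pos (P : R -> Prop) : (forall t, 0 < t -> P t) -> at_right 0 P.
Proof. intros H. exists (mkposreal _ Rlt_0_1). intros t _. apply H. Qed.

(** * Decay, integrability and recurrence of the kernel *)

Lemma kernel_continuous (a b phi t : R) : 0 < t -> continuous (kernel a b phi) t.
Proof.
intros Ht. apply (ex_derive_continuous (kernel a b phi)).
unfold kernel. auto_derive. lra.
Qed.

Lemma kernel_lim_0 (a b phi : R) : 1 < a ->
  filterlim (kernel a b phi) (at_right 0) (locally 0).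
Proof.
intros Ha. apply (filterlim_0_bound _ _ (fun t => exp ((a - 1) * ln t))).
- apply at_right_0_pos. intros t Ht. unfold kernel.
  rewrite Rabs_mult, (Rabs_pos_eq (exp _)) by apply Rlt_le, exp_pos.
  apply Rle_trans with (exp ((a - 1) * ln t - t) * 1).
  + apply Rmult_le_compat_l; [apply Rlt_le, exp_pos|].
    apply Rabs_le, COS_bound.
  + rewrite Rmult_1_r. apply Rlt_le, exp_increasing. lra.
- apply filterlim_exp_ln_0. lra.
Qed.

Lemma kernel_lim_infty (a b phi : R) : 1 < a ->
  filterlim (kernel a b phi) (Rbar_locally p_infty) (locally 0).
Proof.
(* Half of the bound on [s * ln t] absorbs the power into [exp (t / 2)] up to a constant, which
   leaves a decay of [exp (- t / 2)]. *)
intros Ha. set (s := 2 * (a - 1)).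
apply (filterlim_0_bound _ _ (fun t => exp (/ 2 * (s * ln s - s - t)))).
- exists 0. intros t Ht. unfold kernel.
  rewrite Rabs_mult, (Rabs_pos_eq (exp _)) by apply Rlt_le, exp_pos.
  apply Rle_trans with (exp ((a - 1) * ln t - t) * 1).
  + apply Rmult_le_compat_l; [apply Rlt_le, exp_pos|].
    apply Rabs_le, COS_bound.
  + rewrite Rmult_1_r. assert (Hs := mul_ln_le s t ltac:(unfold s; lra) Ht).
    apply exp_le_compat. unfold s in *. lra.
- apply filterlim_comp with (G := Rbar_locally m_infty); [|apply is_lim_exp_m].
  intros P [M HM]. exists (s * ln s - s - 2 * M). intros x Hx. apply HM. lra.
Qed.

Lemma improper_int_kernel (a b phi : R) : 0 < a -> exists l, improper_int (kernel a b phi) l.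
Proof.
intros Ha.
(* dominating function [exp c t^(a-1) / (1+t)^(a+1)], the derivative of
   [exp c (t / (1 + t))^a / a] *)
set (c := (a + 1) * ln (a + 1) - (a + 1) + 1).
apply (improper_int_dominated
  (fun t => exp (c + a * (ln t - ln (1 + t))) / a) _
  (fun t => exp (c + (a - 1) * ln t - (a + 1) * ln (1 + t))) 0 (exp c / a)).
- intros t Ht. auto_derive; [lra|].
  replace (c + (a - 1) * ln t - (a + 1) * ln (1 + t))
    with (c + a * (ln t - ln (1 + t)) + - ln t + - ln (1 + t)) by ring.
  rewrite !exp_plus, !exp_Ropp, !exp_ln by lra. unfold Rminus. field. lra.
- intros t Ht. now apply kernel_continuous.
- intros t Ht.
  apply (ex_derive_continuous (fun t => exp (c + (a - 1) * ln t - (a + 1) * ln (1 + t)))).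
  auto_derive. lra.
- intros t Ht. unfold kernel.
  rewrite Rabs_mult, (Rabs_pos_eq (exp _)) by apply Rlt_le, exp_pos.
  apply Rle_trans with (exp ((a - 1) * ln t - t) * 1).
  + apply Rmult_le_compat_l; [apply Rlt_le, exp_pos|].
    apply Rabs_le, COS_bound.
  (* The constant [c] is chosen so that [mul_ln_le] at exponent [a + 1] and point [1 + t] reads
     [(a + 1) * ln (1 + t) <= t + c]. *)
  + rewrite Rmult_1_r. apply exp_le_compat.
    generalize (mul_ln_le (a + 1) (1 + t) ltac:(lra) ltac:(lra)). unfold c. lra.
- apply (filterlim_0_bound _ _ (fun t => exp c / a * exp (a * ln t))).
  + apply at_right_0_pos. intros t Ht.
    rewrite Rabs_pos_eq.
    2: { apply Rlt_le, Rdiv_lt_0_compat; [apply exp_pos|lra]. }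
    assert (0 <= ln (1 + t)) by (rewrite <- ln_1; apply ln_le; lra).
    replace (exp c / a * exp (a * ln t)) with (exp (c + a * ln t) / a)
      by (rewrite exp_plus; field; lra).
    apply Rmult_le_compat_r; [apply Rlt_le, Rinv_0_lt_compat; lra|].
    apply exp_le_compat. nra.
  + apply (filterlim_comp _ _ _ _ (fun y => exp c / a * y) _ _ _ (filterlim_exp_ln_0 a Ha)).
    rewrite <- (Rmult_0_r (exp c / a)) at 2.
    apply (filterlim_scal_r (V := R_NormedModule) (exp c / a) 0).
(* In the variable [u = / t] the limit at infinity becomes continuity at [u = 0]. *)
- apply (filterlim_ext_loc (fun t => exp (c - a * ln (1 + / t)) / a)).
  + exists 0. intros t Ht. do 2 f_equal.
    replace (1 + / t) with ((1 + t) * / t) by (field; lra).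
    rewrite ln_mult, ln_Rinv by (try apply Rinv_0_lt_compat; lra). ring.
  + apply (filterlim_comp _ _ _ Rinv (fun u => exp (c - a * ln (1 + u)) / a) _ (locally 0)).
    * apply (filterlim_Rbar_inv p_infty). discriminate.
    * replace (exp c / a) with (exp (c - a * ln (1 + 0)) / a).
      2: { rewrite Rplus_0_r, ln_1. do 2 f_equal. ring. }
      apply (ex_derive_continuous (fun u => exp (c - a * ln (1 + u)) / a)).
      auto_derive. lra.
Qed.

(* Integration by parts; this is [Gamma (z + 1) = z Gamma z] with the phase [phi] carried along. *)
Lemma improper_int_kernel_succ (a b phi l l' : R) : 0 < a ->
  improper_int (kernel a b phi) l -> improper_int (kernel a b (phi - PI / 2)) l' ->
  improper_int (kernel (a + 1) b phi) (a * l - b * l').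
Proof.
intros Ha H H'.
(* [D] is the derivative of [kernel (a + 1) b phi]; the shift of the phase by [- PI / 2] turns the
   cosine into the sine. Since [a + 1 > 1], that kernel vanishes at both ends, so [D] has integral
   0. *)
set (D := fun t => a * kernel a b phi t + - b * kernel a b (phi - PI / 2) t
                   - kernel (a + 1) b phi t).
assert (HD : improper_int D (0 - 0)).
{ apply (improper_int_FTC (kernel (a + 1) b phi)).
  - intros t Ht. unfold D, kernel. auto_derive; [lra|].
    replace (b * ln t + (phi - PI / 2)) with (- (PI / 2 - (b * ln t + phi))) by ring.
    rewrite cos_neg, cos_shift.
    assert (E : exp ((a + 1 - 1) * ln t - t) = t * exp ((a - 1) * ln t - t)).
    { rewrite <- (exp_ln t Ht) at 3. rewrite <- exp_plus. f_equal. ring. }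
    unfold Rminus in E |- *. rewrite E. field. lra.
  - intros t Ht. apply (ex_derive_continuous D). unfold D, kernel. auto_derive. lra.
  - apply kernel_lim_0. lra.
  - apply kernel_lim_infty. lra. }
assert (H2 := improper_int_lin _ _ a (- b) _ _ H H').
assert (H3 := improper_int_lin _ _ 1 (-1) _ _ H2 HD).
apply improper_int_ext with (3 := H3); [intros t _; unfold D|]; ring.
Qed.

Lemma improper_int_exp : improper_int (kernel 1 0 0) 1.
Proof.
apply (improper_int_ext (kernel 1 0 0) _ (0 - -1)); [easy|ring|].
apply (improper_int_FTC (fun t => - exp (- t))).
- intros t Ht. unfold kernel. auto_derive; [easy|].
  rewrite !Rmult_0_l, Rplus_0_r, cos_0.
  replace ((1 - 1) * ln t - t) with (- t) by ring. ring.
- intros t Ht. now apply kernel_continuous.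
- replace (-1) with (- exp (- 0)) by (rewrite Ropp_0, exp_0; ring).
  intros P HP. apply filter_le_within. revert P HP.
  apply (ex_derive_continuous (fun t => - exp (- t))). auto_derive. easy.
- apply (filterlim_comp _ _ _ (fun t => exp (- t)) Ropp _ (locally 0));
    [|rewrite <- Ropp_0 at 2; apply (filterlim_opp (V := R_NormedModule) 0)].
  apply filterlim_comp with (G := Rbar_locally m_infty); [|apply is_lim_exp_m].
  intros P [M HM]. exists (- M). intros x Hx. apply HM. lra.
Qed.

(** Supplies the positivity that makes the final estimate in [kernel_int_nonzero] strict. The affine
    minorant [(2 - a) + (a - 1) * t] of [t^(a - 1)] integrates to exactly 1, because Gamma equals 1
    at both 1 and 2. *)
Lemma one_le_improper_int_kernel (a l : R) : 2 <= a ->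
  improper_int (kernel a 0 0) l -> 1 <= l.
Proof.
intros Ha H.
assert (H2 : improper_int (kernel (1 + 1) 0 0) (1 * 1 - 0 * 0)).
{ assert (H0 : improper_int (kernel 1 0 (0 - PI / 2)) 0).
  { apply (improper_int_ext (fun t => 0 * kernel 1 0 0 t + 0 * kernel 1 0 0 t) _
       (0 * 1 + 0 * 1)).
    - intros t _. unfold kernel.
      replace (0 * ln t + (0 - PI / 2)) with (- (PI / 2)) by ring.
      rewrite cos_neg, cos_PI2. ring.
    - ring.
    - apply improper_int_lin; apply improper_int_exp. }
  apply improper_int_kernel_succ; [lra|apply improper_int_exp|exact H0]. }
assert (HL := improper_int_lin _ _ (2 - a) (a - 1) _ _ improper_int_exp H2).
replace 1 with ((2 - a) * 1 + (a - 1) * (1 * 1 - 0 * 0)) by ring.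
(* Bernoulli's inequality [1 + (a - 1) (t - 1) <= t^(a - 1)], integrated against [exp (- t)] *)
apply improper_int_le with (2 := HL) (3 := H).
intros t Ht. unfold kernel. rewrite !Rmult_0_l, Rplus_0_r, cos_0.
replace ((1 - 1) * ln t - t) with (- t) by ring.
replace ((1 + 1 - 1) * ln t - t) with (- t + ln t) by ring.
replace ((a - 1) * ln t - t) with (- t + (ln t + (a - 2) * ln t)) by ring.
rewrite !exp_plus, exp_ln by assumption.
assert (H3 : 1 + (a - 2) * ln t <= exp ((a - 2) * ln t)) by apply exp_ineq1_le.
assert (H4 : t - 1 <= t * ln t).
{ generalize (exp_ineq1_le (- ln t)). rewrite exp_Ropp, exp_ln by assumption. intros H4.
  apply (Rmult_le_compat_l t) in H4; [|lra].
  rewrite Rinv_r in H4 by lra. lra. }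
assert (H5 := exp_pos (- t)).
assert (H6 : 1 + (a - 1) * (t - 1) <= t * exp ((a - 2) * ln t)).
{ apply Rle_trans with (t * (1 + (a - 2) * ln t)).
  - assert ((a - 2) * (t - 1) <= (a - 2) * (t * ln t)) by (apply Rmult_le_compat_l; lra).
    lra.
  - apply Rmult_le_compat_l; lra. }
replace ((2 - a) * (exp (- t) * 1) + (a - 1) * (exp (- t) * t * 1))
  with (exp (- t) * (1 + (a - 1) * (t - 1))) by ring.
rewrite Rmult_1_r. apply Rmult_le_compat_l; lra.
Qed.

(** * Elementary inequalities for the cosine and the logarithm *)

Lemma cos_ge (u : R) : 1 - u ^ 2 / 2 <= cos u.
Proof.
replace u with (2 * (u / 2)) at 2 by field. rewrite cos_2a_sin.
assert (H : Rabs (sin (u / 2)) <= Rabs (u / 2)).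
{ assert (P : forall v, 0 <= v -> Rabs (sin v) <= v).
  { intros v Hv. destruct (Rle_lt_dec v 1) as [H1|H1].
    - destruct Hv as [Hv| <-]; [|rewrite sin_0, Rabs_R0; lra].
      assert (H2 := PI2_1). assert (H3 := PI2_Rlt_PI).
      rewrite Rabs_pos_eq by (apply sin_ge_0; lra).
      now apply Rlt_le, sin_lt_x.
    - apply Rle_trans with 1; [|lra]. apply Rabs_le, SIN_bound. }
  destruct (Rle_lt_dec 0 (u / 2)) as [H1|H1].
  - rewrite (Rabs_pos_eq (u / 2)) by lra. now apply P.
  - rewrite (Rabs_left (u / 2)), <- (Rabs_Ropp (sin _)), <- sin_neg by lra. apply P; lra. }
apply Rsqr_le_abs_1 in H. unfold Rsqr in H. lra.
Qed.

(** Both sides are invariant under [s -> / s], so [1 <= s] may be assumed; with [v = ln s / 2] they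
    are then the squares of [2 v] and of [2 sinh v]. *)
Lemma ln_sqr_le (s : R) : 0 < s -> ln s ^ 2 <= s + / s - 2.
Proof.
intros Hs.
(* [2 sinh (v) >= 2 v] for [v = ln s / 2 >= 0] *)
assert (P : forall s, 1 <= s -> ln s ^ 2 <= s + / s - 2).
{ clear s Hs. intros s Hs.
  set (v := ln s / 2).
  assert (Hv : 0 <= v).
  { assert (0 <= ln s) by (rewrite <- ln_1; apply ln_le; lra). unfold v; lra. }
  assert (Hsinh : 2 * v <= exp v - exp (- v)).
  { destruct Hv as [Hv|Hv]; [|rewrite <- Hv, Ropp_0; lra].
    destruct (MVT_gen (fun v => exp v - exp (- v)) 0 v (fun v => exp v + exp (- v)))
      as (w & Hw & Hm).
    - intros w _. auto_derive; [easy|ring].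
    - intros w _. apply continuity_pt_filterlim.
      apply (ex_derive_continuous (fun v => exp v - exp (- v))). auto_derive. easy.
    - rewrite Ropp_0, exp_0 in Hm.
      assert (2 <= exp w + exp (- w)).
      { generalize (exp_ineq1_le w) (exp_ineq1_le (- w)). lra. }
      assert (2 * v <= (exp w + exp (- w)) * v) by (apply Rmult_le_compat_r; lra).
      lra. }
  assert (E1 : exp v * exp v = s).
  { rewrite <- exp_plus. unfold v. replace (ln s / 2 + ln s / 2) with (ln s) by field.
    apply exp_ln; lra. }
  assert (E2 : exp (- v) * exp (- v) = / s).
  { rewrite exp_Ropp, <- Rinv_mult, E1. easy. }
  assert (E3 : exp v * exp (- v) = 1).
  { rewrite <- exp_plus, Rplus_opp_r. apply exp_0. }
  replace (ln s) with (2 * v) by (unfold v; field).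
  assert ((2 * v) ^ 2 <= (exp v - exp (- v)) ^ 2) by (apply pow_incr; lra).
  lra. }
destruct (Rle_lt_dec 1 s) as [H|H]; [now apply P|].
assert (1 <= / s) by (rewrite <- Rinv_1; apply Rinv_le_contravar; lra).
generalize (P (/ s) H0). rewrite ln_Rinv, Rinv_inv by assumption. lra.
Qed.

(* Under the probability density [t^(x-1) exp (-t) / Gamma x] the variable [t/x] has mean 1
   and its inverse has mean [x/(x-1)], so [cos (y ln (t/x))], which is at least
   [1 - y^2/2 (t/x + x/t - 2)], has positive mean for large [x]. *)
Lemma kernel_int_nonzero (x y : R) : 3 + y ^ 2 / 2 <= x ->
  ~ (forall phi, improper_int (kernel x y phi) 0).
Proof.
intros Hx HZ. assert (Hy := pow2_ge_0 y).
destruct (improper_int_kernel (x - 1) 0 0 ltac:(lra)) as [g Hg].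
(* The 3 in the hypothesis on [x] gives [2 <= x - 1] here; the term [y ^ 2 / 2] keeps the last
   factor [x - 1 - y ^ 2 / 2] positive. With [g] for Gamma at [x - 1], its values at [x] and [x + 1]
   are [(x - 1) * g] and [x * (x - 1) * g]. *)
assert (Hg1 := one_le_improper_int_kernel (x - 1) g ltac:(lra) Hg).
assert (Hsucc : forall a l, 0 < a -> improper_int (kernel a 0 0) l ->
    improper_int (kernel (a + 1) 0 0) (a * l)).
{ intros a l Ha H.
  destruct (improper_int_kernel a 0 (0 - PI / 2) Ha) as [l' Hl'].
  apply improper_int_ext with (3 := improper_int_kernel_succ _ _ _ _ _ Ha H Hl');
    [easy|ring]. }
assert (H0 := Hsucc (x - 1) g ltac:(lra) Hg).
replace (x - 1 + 1) with x in H0 by ring.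
assert (H1 := Hsucc x ((x - 1) * g) ltac:(lra) H0).
assert (HL := improper_int_lin _ _ (1 + y ^ 2) (- (y ^ 2 / 2)) _ _ H0
   (improper_int_lin _ _ (/ x) x _ _ H1 Hg)).
assert (Hle : (1 + y ^ 2) * ((x - 1) * g)
   + - (y ^ 2 / 2) * (/ x * (x * ((x - 1) * g)) + x * g) <= 0).
(* The phase [- (y * ln x)] centres the oscillation at [t = x], where the density concentrates: the
   cosine becomes that of [y * ln (t / x)]. *)
{ apply improper_int_le with (2 := HL) (3 := HZ (- (y * ln x))).
  intros t Ht. unfold kernel. rewrite !Rmult_0_l, Rplus_0_r, cos_0, !Rmult_1_r.
  set (w := exp ((x - 1) * ln t - t)).
  assert (E1 : exp ((x + 1 - 1) * ln t - t) = w * t).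
  { rewrite <- (exp_ln t Ht) at 3. unfold w. rewrite <- exp_plus. f_equal. ring. }
  assert (E2 : exp ((x - 1 - 1) * ln t - t) = w * / t).
  { rewrite <- (exp_ln t Ht) at 3. unfold w. rewrite <- exp_Ropp, <- exp_plus.
    f_equal. ring. }
  rewrite E1, E2.
  assert (Hc := cos_ge (y * ln t + - (y * ln x))).
  assert (Htx : 0 < t / x) by (apply Rdiv_lt_0_compat; lra).
  assert (Hl := ln_sqr_le (t / x) Htx).
  rewrite ln_div in Hl by lra.
  replace (/ (t / x)) with (x / t) in Hl by (field; lra).
  apply (Rmult_le_compat_l (y ^ 2)) in Hl; [|assumption].
  apply Rle_trans with
    (w * (1 - y ^ 2 * (t / x + x / t - 2) / 2)); [right; field; lra|].
  apply Rmult_le_compat_l.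
  - apply Rlt_le, exp_pos.
  - replace ((y * ln t + - (y * ln x)) ^ 2) with (y ^ 2 * (ln t - ln x) ^ 2) in Hc by ring.
    lra. }
replace ((1 + y ^ 2) * ((x - 1) * g)
   + - (y ^ 2 / 2) * (/ x * (x * ((x - 1) * g)) + x * g))
  with ((x - 1 - y ^ 2 / 2) * g) in Hle by (field; lra).
assert (0 < (x - 1 - y ^ 2 / 2) * g) by (apply Rmult_lt_0_compat; lra).
lra.
Qed.

(** * Non-vanishing of the complex Gamma function *)

Lemma Gamma_kernel (z : C) (lr li : R) :
  improper_int (kernel (Re z) (Im z) 0) lr ->
  improper_int (kernel (Re z) (Im z) (- (PI / 2))) li ->
  Gamma z = (lr, li).
Proof.
intros Hr Hi.
refine (is_RInt_gen_unique (V := C_R_CompleteNormedModule) _ _ _).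
assert (E : forall t, Rpower t (Re z - 1) * exp (- t) = exp ((Re z - 1) * ln t - t)).
{ intros t. unfold Rpower. now rewrite <- exp_plus. }
apply improper_int_pair;
[ refine (improper_int_ext _ _ lr lr _ eq_refl Hr)
| refine (improper_int_ext _ _ li li _ eq_refl Hi)];
intros t Ht; unfold kernel, cpower, Cmult, Re, Im; simpl;
rewrite <- E; unfold Re; simpl; replace (snd z + - 0) with (snd z) by ring.
- rewrite Rplus_0_r. unfold Rminus. ring.
- replace (snd z * ln t + - (PI / 2)) with (- (PI / 2 - snd z * ln t)) by ring.
  rewrite cos_neg, cos_shift. unfold Rminus. ring.
Qed.

Lemma Gamma_neq_0 (z : C) : 0 < Re z -> Gamma z <> 0%C.
Proof.
intros Hz HG.
destruct (improper_int_kernel (Re z) (Im z) 0 Hz) as [lr Hr].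
destruct (improper_int_kernel (Re z) (Im z) (- (PI / 2)) Hz) as [li Hi].
rewrite (Gamma_kernel z lr li Hr Hi) in HG. injection HG as -> ->.
(* By the addition formula every phase is a combination of the phases 0 and [- PI / 2]. Vanishing
   for all phases at once is what passes from [x] to [x + 1], as the recurrence shifts the phase. *)
assert (H0 : forall phi, improper_int (kernel (Re z) (Im z) phi) 0).
{ intros phi.
  apply improper_int_ext with (3 := improper_int_lin _ _ (cos phi) (- sin phi) _ _ Hr Hi);
    [|ring].
  intros t Ht. unfold kernel.
  replace (Im z * ln t + - (PI / 2)) with (- (PI / 2 - Im z * ln t)) by ring.
  rewrite cos_neg, cos_shift, Rplus_0_r, cos_plus. ring. }
assert (Hn : forall n phi, improper_int (kernel (Re z + INR n) (Im z) phi) 0).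
{ induction n as [|n IH]; intros phi.
  - simpl. rewrite Rplus_0_r. apply H0.
  - rewrite S_INR, <- Rplus_assoc.
    assert (Hpos : 0 < Re z + INR n) by (generalize (pos_INR n); lra).
    apply improper_int_ext with
      (3 := improper_int_kernel_succ _ _ _ _ _ Hpos (IH phi) (IH (phi - PI / 2)));
    [easy|ring]. }
destruct (INR_unbounded (3 + Im z ^ 2 / 2)) as [n Hlt].
apply (kernel_int_nonzero (Re z + INR n) (Im z)); [lra|apply Hn].
Qed.

(** * The V-derivative in terms of the ordinary derivative *)

Lemma is_derive_is_lim (g : R -> R) (t l : R) :
  is_derive g t l <-> is_lim (fun e => (g (t + e) - g t) / e) 0 l.
Proof.
rewrite is_derive_Reals, <- is_lim_spec. unfold derivable_pt_lim. split.
- intros H eps. destruct (H eps (cond_pos eps)) as [delta Hd].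
  exists delta. intros y Hy Hy0. apply Hd; [exact Hy0|].
  change (Rabs (y - 0) < delta) in Hy. now rewrite Rminus_0_r in Hy.
- intros H eps Heps. destruct (H (mkposreal eps Heps)) as [delta Hd].
  exists delta. intros k Hk0 Hk. apply Hd; [|exact Hk0].
  change (Rabs (k - 0) < delta). now rewrite Rminus_0_r.
Qed.

Lemma is_lim_quotient_comp (g h : R -> R) (t d l : R) :
  h 0 = t -> is_derive h 0 d -> is_derive g t l ->
  is_lim (fun e => (g (h e) - g t) / e) 0 (d * l).
Proof.
intros H0 Hh Hg.
apply (is_lim_ext (fun e => (g (h (0 + e)) - g (h 0)) / e)).
{ intros e. now rewrite Rplus_0_l, H0. }
apply (is_derive_is_lim (fun e => g (h e))).
apply (is_derive_comp g h); [now rewrite H0|exact Hh].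
Qed.

(* Every [y] near [t] is [h e] for a small [e] by the intermediate value theorem, and
   [(g y - g t) / (y - t)] is the quotient of [(g (h e) - g t) / e] by [(h e - t) / e]. *)
Lemma is_derive_of_quotient_comp (g h : R -> R) (t d L : R) :
  continuity h -> h 0 = t -> is_derive h 0 d -> d <> 0 ->
  is_lim (fun e => (g (h e) - g t) / e) 0 L -> is_derive g t (L / d).
Proof.
intros Hc H0 Hh Hd HL.
apply is_derive_is_lim in Hh.
assert (Hq : is_lim (fun e => (g (h e) - g t) / e / ((h (0 + e) - h 0) / e)) 0 (L / d)).
{ apply (is_lim_div _ _ 0 L d HL Hh).
  - intros E. apply Hd. now injection E.
  - exact I. }
apply is_derive_is_lim. apply is_lim_spec. intros eps.
destruct (proj2 (is_lim_spec _ _ _) Hq eps) as [d1 Hd1].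
assert (Hd2 : 0 < Rabs d / 2) by (generalize (Rabs_pos_lt d Hd); lra).
destruct (proj2 (is_lim_spec _ _ _) Hh (mkposreal _ Hd2)) as [d2 Hd2'].
set (r := Rmin d1 d2 / 2).
assert (Hr : 0 < r /\ r < d1 /\ r < d2).
{ generalize (Rmin_l d1 d2) (Rmin_r d1 d2)
    (Rmin_pos d1 d2 (cond_pos d1) (cond_pos d2)). unfold r. lra. }
assert (Hinc : forall e, e <> 0 -> Rabs e < d2 -> Rabs (h e - t - d * e) <= Rabs d / 2 * Rabs e).
{ intros e He0 He. specialize (Hd2' e). simpl in Hd2'.
  assert (HB : ball 0 d2 e) by (change (Rabs (e - 0) < d2); now rewrite Rminus_0_r).
  specialize (Hd2' HB He0). rewrite Rplus_0_l, H0 in Hd2'.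
  replace (h e - t - d * e) with (((h e - t) / e - d) * e) by (field; assumption).
  rewrite Rabs_mult. apply Rmult_le_compat_r; [apply Rabs_pos|lra]. }
assert (Hk : 0 < Rabs d / 2 * r) by (apply Rmult_lt_0_compat; lra).
exists (mkposreal _ Hk). intros k Hkr Hk0.
change (Rabs (k - 0) < Rabs d / 2 * r) in Hkr. rewrite Rminus_0_r in Hkr.
(* By [Hinc], [h r] and [h (- r)] lie on opposite sides of [t], each at distance at least
   [Rabs d / 2 * r], so [t + k] is between them; the sign of [d] decides their order. *)
destruct (IVT_gen h (- r) r (t + k) Hc) as [e [He Hek]].
{ assert (Hp := Hinc r ltac:(lra)). assert (Hm := Hinc (- r) ltac:(lra)).
  rewrite Rabs_Ropp in Hm. rewrite Rabs_pos_eq in Hp, Hm by lra.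
  specialize (Hp ltac:(lra)). specialize (Hm ltac:(lra)).
  apply Rabs_le_between in Hp. apply Rabs_le_between in Hm. apply Rabs_def2 in Hkr.
  destruct (Rle_lt_dec 0 d) as [Hs|Hs].
  - rewrite Rabs_pos_eq in Hp, Hm, Hkr by assumption.
    rewrite Rmin_left, Rmax_right by lra. lra.
  - rewrite Rabs_left in Hp, Hm, Hkr by assumption.
    rewrite Rmin_right, Rmax_left by lra. lra. }
rewrite Rmin_left, Rmax_right in He by lra.
assert (He0 : e <> 0). { intros ->. lra. }
assert (HB : ball 0 d1 e).
{ change (Rabs (e - 0) < d1). rewrite Rminus_0_r. apply Rabs_def1; lra. }
specialize (Hd1 e HB He0). simpl in Hd1 |- *.
rewrite Rplus_0_l, H0, Hek in Hd1.
replace ((g (t + k) - g t) / k) with ((g (t + k) - g t) / e / ((t + k - t) / e)).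
- exact Hd1.
- field. repeat split; assumption.
Qed.

(** * The truncated series as a polynomial *)

Lemma ex_derive_real_poly (b : nat -> R) (n : nat) (x : R) :
  ex_derive (fun x => sum_n (fun k => b k * x ^ k) n) x.
Proof.
eexists. apply (is_derive_sum_n (fun k x => b k * x ^ k)).
intros k _. auto_derive; [easy|reflexivity].
Qed.

Lemma is_derive_real_poly_0 (b : nat -> R) (n : nat) : (1 <= n)%nat ->
  is_derive (fun x => sum_n (fun k => b k * x ^ k) n) 0 (b 1%nat).
Proof.
induction 1 as [|n Hn IH].
- apply (is_derive_ext (fun x => b O + b 1%nat * x)).
  + intros x. rewrite sum_Sn, sum_O. unfold plus; simpl. ring.
  + auto_derive; [easy|ring].
- apply (is_derive_ext (fun x => sum_n (fun k => b k * x ^ k) n + b (S n) * x ^ S n)).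
  + intros x. rewrite sum_Sn. reflexivity.
  + replace (b 1%nat) with (b 1%nat + 0) by ring.
    apply (is_derive_plus (V := R_NormedModule)); [exact IH|].
    auto_derive; [easy|].
    destruct n as [|n]; [lia|]. simpl. ring.
Qed.

(** The factor [Gamma beta] is absorbed, so the coefficient of index 0 is 1 and that of index 1 is
    the constant of the composition formula. *)
Definition coefH (gamma beta rho delta : C) (p q : R) (k : nat) : C :=
  (Gamma beta * (poch rho (q * INR k) / poch delta (p * INR k)
    / Gamma (gamma * RtoC (INR k) + beta)))%C.

Lemma Re_Im_sum_n (u : nat -> C) (n : nat) :
  Re (sum_n u n) = sum_n (fun k => Re (u k)) n /\
  Im (sum_n u n) = sum_n (fun k => Im (u k)) n.
Proof.
induction n as [|n [IHr IHi]].
- now rewrite !sum_O.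
- rewrite !sum_Sn, <- IHr, <- IHi. now split.
Qed.

Lemma truncH_real (i : nat) (gamma beta rho delta : C) (p q x : R) :
  truncH i gamma beta rho delta p q (RtoC x)
  = sum_n (fun k => (coefH gamma beta rho delta p q k * RtoC (x ^ k))%C) i.
Proof.
unfold truncH.
etransitivity; [symmetry; exact (sum_n_mult_l (K := C_Ring) (Gamma beta) _ i)|].
apply sum_n_ext. intros k. unfold mult; simpl.
rewrite RtoC_pow. unfold coefH, Cdiv. ring.
Qed.

Lemma Re_truncH (i : nat) (gamma beta rho delta : C) (p q x : R) :
  Re (truncH i gamma beta rho delta p q (RtoC x))
  = sum_n (fun k => Re (coefH gamma beta rho delta p q k) * x ^ k) i.
Proof.
rewrite truncH_real, (proj1 (Re_Im_sum_n _ i)).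
apply sum_n_ext. intros k. apply re_scal_r.
Qed.

Lemma Im_truncH (i : nat) (gamma beta rho delta : C) (p q x : R) :
  Im (truncH i gamma beta rho delta p q (RtoC x))
  = sum_n (fun k => Im (coefH gamma beta rho delta p q k) * x ^ k) i.
Proof.
rewrite truncH_real, (proj2 (Re_Im_sum_n _ i)).
apply sum_n_ext. intros k. apply im_scal_r.
Qed.

Lemma real_poly_0 (b : nat -> R) (n : nat) :
  sum_n (fun k => b k * 0 ^ k) n = b O.
Proof.
induction n as [|n IH].
- rewrite sum_O. simpl. ring.
- rewrite sum_Sn, IH. unfold plus; simpl. ring.
Qed.

(** The quotient of [Gamma x] by itself is 1 because [Gamma x] is nonzero; this gives the series the
    value 1 at 0. *)
Lemma poch_0 (x : C) : 0 < Re x -> poch x 0 = 1%C.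
Proof.
intros Hx. unfold poch. rewrite Cplus_0_r. unfold Cdiv.
now apply Cinv_r, Gamma_neq_0.
Qed.

Lemma Cinv_neq_0 (z : C) : z <> 0%C -> (/ z)%C <> 0%C.
Proof.
intros Hz H. apply C1_nz. rewrite <- (Cinv_l z Hz), H. apply Cmult_0_l.
Qed.

Lemma poch_neq_0 (x : C) (s : R) : 0 < Re x -> 0 < s -> poch x s <> 0%C.
Proof.
intros Hx Hs. unfold poch, Cdiv. apply Cmult_neq_0.
- apply Gamma_neq_0. rewrite re_plus. simpl. lra.
- apply Cinv_neq_0, Gamma_neq_0, Hx.
Qed.

Lemma coefH_0 (gamma beta rho delta : C) (p q : R) :
  0 < Re beta -> 0 < Re rho -> 0 < Re delta ->
  coefH gamma beta rho delta p q 0 = 1%C.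
Proof.
intros Hb Hr Hd. unfold coefH. simpl INR.
rewrite !Rmult_0_r, !poch_0, Cmult_0_r, Cplus_0_l by assumption.
field. now apply Gamma_neq_0.
Qed.

Lemma coefH_1 (gamma beta rho delta : C) (p q : R) :
  0 < p -> 0 < q -> 0 < Re gamma -> 0 < Re beta -> 0 < Re delta ->
  coefH gamma beta rho delta p q 1
  = (Gamma beta * poch rho q / (Gamma (gamma + beta) * poch delta p))%C.
Proof.
intros Hp Hq Hg Hb Hd. unfold coefH. simpl INR.
rewrite !Rmult_1_r, Cmult_1_r. field.
split; [now apply poch_neq_0|apply Gamma_neq_0; rewrite re_plus; lra].
Qed.

Lemma coefH_1_neq_0 (gamma beta rho delta : C) (p q : R) :
  0 < p -> 0 < q -> 0 < Re gamma -> 0 < Re beta -> 0 < Re rho -> 0 < Re delta ->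
  coefH gamma beta rho delta p q 1 <> 0%C.
Proof.
intros Hp Hq Hg Hb Hr Hd. rewrite coefH_1 by assumption.
assert (H1 : Gamma (gamma + beta) <> 0%C) by (apply Gamma_neq_0; rewrite re_plus; lra).
assert (H2 := poch_neq_0 delta p Hd Hp).
assert (H3 := poch_neq_0 rho q Hr Hq).
assert (H4 := Gamma_neq_0 beta Hb).
unfold Cdiv. apply Cmult_neq_0; [now apply Cmult_neq_0|].
now apply Cinv_neq_0, Cmult_neq_0.
Qed.

Lemma Re_Varg (i : nat) (gamma beta rho delta : C) (p q a t e : R) :
  Re (Varg i gamma beta rho delta p q a t e)
  = t * Re (truncH i gamma beta rho delta p q (RtoC (e * Rpower t (- a)))).
Proof. apply re_scal_l. Qed.

Lemma Im_Varg (i : nat) (gamma beta rho delta : C) (p q a t e : R) :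
  Im (Varg i gamma beta rho delta p q a t e)
  = t * Im (truncH i gamma beta rho delta p q (RtoC (e * Rpower t (- a)))).
Proof. apply im_scal_l. Qed.

(** The assumptions concern the series alone, so one instance serves every function, every point and
    every real order, including [alpha + mu], which may exceed 1. Differentiability gives the
    V-derivative by the chain rule; the converse is [is_derive_of_quotient_comp]. *)
Lemma ex_V_iff_ex_derive (i : nat) (gamma beta rho delta : C) (p q c : R) :
  locally 0 (fun x => Im (truncH i gamma beta rho delta p q (RtoC x)) = 0) ->
  (forall x, ex_derive (fun x => Re (truncH i gamma beta rho delta p q (RtoC x))) x) ->
  Re (truncH i gamma beta rho delta p q (RtoC 0)) = 1 ->
  is_derive (fun x => Re (truncH i gamma beta rho delta p q (RtoC x))) 0 c ->
  c <> 0 ->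
  forall (a : R) (g : R -> R) (t : R), 0 < t ->
    (ex_V i gamma beta rho delta p q a g t <-> ex_derive g t) /\
    (ex_derive g t ->
     Vderiv i gamma beta rho delta p q a g t = c * Rpower t (1 - a) * Derive g t).
Proof.
intros HIm Hex HR0 HRd Hc a g t Ht.
set (H := fun x => truncH i gamma beta rho delta p q (RtoC x)) in *.
set (r := Rpower t (- a)).
set (h := fun e => t * Re (H (e * r))).
set (d := c * Rpower t (1 - a)).
assert (Hr : r <> 0) by (apply Rgt_not_eq, exp_pos).
assert (Htr : t * r = Rpower t (1 - a)).
{ unfold r. rewrite <- (Rpower_1 t) at 1 by assumption.
  rewrite <- Rpower_plus. now f_equal. }
assert (Hd : d <> 0).
{ apply Rmult_integral_contrapositive_currified; [exact Hc|apply Rgt_not_eq, exp_pos]. }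
assert (Hh0 : h 0 = t).
{ unfold h. rewrite Rmult_0_l. unfold H. rewrite HR0. ring. }
assert (Hhd : is_derive h 0 d).
{ replace d with (t * (r * c)) by (unfold d; rewrite <- Htr; ring).
  apply is_derive_scal.
  apply (is_derive_comp (fun x => Re (H x)) (fun e => e * r)).
  - now rewrite Rmult_0_l.
  - auto_derive; [easy|ring]. }
assert (Hhc : continuity h).
{ intros e. apply continuity_pt_filterlim. apply (ex_derive_continuous h).
  unfold h. apply ex_derive_scal.
  apply (ex_derive_comp (fun x => Re (H x)) (fun e => e * r)); [apply Hex|].
  auto_derive. easy. }
(* The domain clause of [ex_V] holds for every [g]: near 0 the argument is real by assumption, and
   positive because [h] is continuous with [h 0 = t > 0]. *)
assert (Hdom : locally' 0 (fun e => Im (Varg i gamma beta rho delta p q a t e) = 0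
    /\ 0 <= Re (Varg i gamma beta rho delta p q a t e))).
{ apply filter_le_within.
  apply (filter_imp (fun e => Im (H (e * r)) = 0 /\ 0 < h e)).
  - intros e [HI HR]. rewrite Im_Varg, Re_Varg. split.
    + change (t * Im (H (e * r)) = 0). rewrite HI. ring.
    + now apply Rlt_le.
  - apply filter_and.
    + assert (Hcont : continuous (fun e => e * r) 0).
      { apply (ex_derive_continuous (fun e => e * r)). auto_derive. easy. }
      apply (Hcont (fun x => Im (H x) = 0)). now rewrite Rmult_0_l.
    + assert (Hcont : continuous h 0).
      { apply (ex_derive_continuous h). now exists d. }
      apply (Hcont (fun x => 0 < x)). rewrite Hh0. now apply open_gt. }
assert (Hquot : forall l, is_derive g t l ->
    is_lim (Vquot i gamma beta rho delta p q a g t) 0 (d * l)).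
{ intros l Hl. apply (is_lim_ext (fun e => (g (h e) - g t) / e)).
  - intros e. unfold Vquot. now rewrite Re_Varg.
  - now apply is_lim_quotient_comp. }
split; [split|].
- intros [_ [L HL]]. exists (L / d).
  apply (is_derive_of_quotient_comp g h t d L); try assumption.
  apply is_lim_ext with (2 := HL).
  intros e. unfold Vquot. now rewrite Re_Varg.
- intros [l Hl]. split; [exact Hdom|]. exists (d * l). now apply Hquot.
- intros Hg. unfold Vderiv.
  rewrite (is_lim_unique _ _ _ (Hquot _ (Derive_correct _ _ Hg))). easy.
Qed.

(** Covers truncation at index 0: the argument of [g] stays at [t], so every difference quotient is
    0, whatever [g] is. *)
Lemma V_eq_0_of_truncH_eq_1 (i : nat) (gamma beta rho delta : C) (p q a : R) (g : R -> R) (t : R) :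
  (forall z, truncH i gamma beta rho delta p q z = 1%C) ->
  0 < t ->
  ex_V i gamma beta rho delta p q a g t /\ Vderiv i gamma beta rho delta p q a g t = 0.
Proof.
intros H1 Ht.
assert (HV : forall e, Vquot i gamma beta rho delta p q a g t e = 0).
{ intros e. unfold Vquot. rewrite Re_Varg, H1. simpl. rewrite Rmult_1_r.
  unfold Rdiv. ring. }
assert (HL : is_lim (Vquot i gamma beta rho delta p q a g t) 0 0).
{ apply (is_lim_ext (fun _ => 0)); [now intros|apply is_lim_const]. }
split.
- split; [|now exists 0].
  apply filter_forall. intros e. rewrite Im_Varg, Re_Varg, H1. simpl. lra.
- unfold Vderiv. now rewrite (is_lim_unique _ _ _ HL).
Qed.

(** The values of [Vderiv] are meaningful only where the limits exist, hence the equivalence of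
    existence before the formula. [Derive f] is the true derivative on the positive half-line when
    [i >= 1], since [f] is then differentiable there; for [i = 0] all V-derivatives are 0. *)
Theorem theorem5 (i : nat) (gamma beta rho delta : C) (p q alpha mu : R)
    (f : R -> R)
    (hp : 0 < p) (hq : 0 < q)
    (hgamma : 0 < Re gamma) (hbeta : 0 < Re beta)
    (hrho : 0 < Re rho) (hdelta : 0 < Re delta)
    (hpq : Re gamma + p >= q)
    (halpha : 0 < alpha < 1) (hmu : 0 < mu < 1)
    (hfalpha : forall s : R, 0 < s -> ex_V i gamma beta rho delta p q alpha f s)
    (hfmu : forall s : R, 0 < s -> ex_V i gamma beta rho delta p q mu f s) :
  let exV := ex_V i gamma beta rho delta p q in
  let V := Vderiv i gamma beta rho delta p q in
  forall t : R, 0 < t ->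
    (exV alpha (V mu f) t
       <-> exV (alpha + mu) f t /\ exV (alpha + mu) (Derive f) t)
    /\ (exV alpha (V mu f) t ->
        RtoC (V alpha (V mu f) t)
        = (Gamma beta * poch rho q / (Gamma (gamma + beta) * poch delta p)
           * ((1 - RtoC mu) * RtoC (V (alpha + mu)%R f t)
              + RtoC t * RtoC (V (alpha + mu)%R (Derive f) t)))%C).
Proof.
intros exV V t Ht. subst exV V.
assert (Hc0 := coefH_0 gamma beta rho delta p q hbeta hrho hdelta).
assert (Hc1 := coefH_1_neq_0 gamma beta rho delta p q hp hq hgamma hbeta hrho hdelta).
rewrite <- coefH_1 by assumption.
destruct (Nat.eq_dec i 0) as [Hi|Hi].
- assert (H1 : forall z, truncH i gamma beta rho delta p q z = 1%C).
  { intros z. rewrite Hi, <- Hc0. unfold truncH, coefH. rewrite sum_O. simpl.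
    unfold Cdiv. ring. }
  assert (HV := fun a g => V_eq_0_of_truncH_eq_1 i gamma beta rho delta p q a g t H1 Ht).
  split.
  + split; [intros _; split|intros _]; apply HV.
  + intros _. rewrite !(proj2 (HV _ _)). ring.
- set (w := coefH gamma beta rho delta p q 1) in *.
  assert (Hi1 : (1 <= i)%nat) by lia.
  (* At the point 1 the factor [1^(- mu)] disappears, so existence of the derivative there says that
     the series is real on a punctured neighbourhood of 0; at 0 itself its value is 1. *)
  assert (HIm : locally 0 (fun x => Im (truncH i gamma beta rho delta p q (RtoC x)) = 0)).
  { destruct (hfmu 1 Rlt_0_1) as [[eps Heps] _]. exists eps. intros x Hx.
    destruct (Req_dec x 0) as [->|Hx0].
    - rewrite Im_truncH, real_poly_0, Hc0. easy.
    - destruct (Heps x Hx Hx0) as [H _]. rewrite Im_Varg in H.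
      unfold Rpower in H. rewrite ln_1, Rmult_0_r, exp_0, Rmult_1_r, Rmult_1_l in H.
      exact H. }
  (* [Im w] is the derivative at 0 of the imaginary part of the series, which vanishes near 0. *)
  assert (Hw : Im w = 0).
  { rewrite <- (is_derive_unique _ _ _ (is_derive_real_poly_0
      (fun k => Im (coefH gamma beta rho delta p q k)) i Hi1) : _ = Im w).
    rewrite (Derive_ext_loc _ (fun _ => 0)); [apply Derive_const|].
    apply filter_imp with (2 := HIm). intros x Hx. now rewrite Im_truncH in Hx. }
  set (c := Re w).
  assert (Ewc : w = RtoC c).
  { apply injective_projections; [easy|exact Hw]. }
  assert (Hc : c <> 0) by (intros E; apply Hc1; now rewrite Ewc, E).
  assert (HV := ex_V_iff_ex_derive i gamma beta rho delta p q c HIm).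
  specialize (HV (fun x => ex_derive_ext _ _ x
     (fun y => eq_sym (Re_truncH i gamma beta rho delta p q y))
     (ex_derive_real_poly (fun k => Re (coefH gamma beta rho delta p q k)) i x))).
  assert (HR0 : Re (truncH i gamma beta rho delta p q (RtoC 0)) = 1).
  { now rewrite Re_truncH, real_poly_0, Hc0. }
  specialize (HV HR0 (is_derive_ext _ _ 0 c
     (fun y => eq_sym (Re_truncH i gamma beta rho delta p q y))
     (is_derive_real_poly_0 (fun k => Re (coefH gamma beta rho delta p q k)) i Hi1)) Hc).
  clear HR0.
  assert (Hf : forall s, 0 < s -> ex_derive f s).
  { intros s Hs. apply (HV mu f s Hs), hfmu, Hs. }
  set (k := fun s => c * Rpower s (1 - mu)).
  (* A formula on a whole neighbourhood of [t] is required, since this function is differentiated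
     again. *)
  assert (HVf : locally t (fun s => Vderiv i gamma beta rho delta p q mu f s
      = k s * Derive f s)).
  { apply (filter_imp (fun s => 0 < s)); [|now apply open_gt].
    intros s Hs. now apply HV, Hf. }
  assert (Hk : is_derive k t (c * ((1 - mu) * Rpower t (- mu)))).
  { apply is_derive_scal, is_derive_Reals.
    replace (- mu) with (1 - mu - 1) by ring. now apply derivable_pt_lim_power. }
  assert (Hk0 : forall s, k s <> 0).
  { intros s. apply Rmult_integral_contrapositive_currified;
      [exact Hc|apply Rgt_not_eq, exp_pos]. }
  (* The factor [k] is differentiable at [t] and never 0, so multiplying or dividing by it preserves
     differentiability at [t]. *)
  assert (Hiff : ex_derive (Vderiv i gamma beta rho delta p q mu f) t
                 <-> ex_derive (Derive f) t).
  { split; intros HD.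
    - apply (ex_derive_ext_loc
        (fun s => Vderiv i gamma beta rho delta p q mu f s / k s)).
      + apply filter_imp with (2 := HVf). intros s ->.
        change (k s * Derive f s / k s = Derive f s). field. apply Hk0.
      + apply ex_derive_div; [exact HD|eexists; exact Hk|apply Hk0].
    - apply (ex_derive_ext_loc (fun s => k s * Derive f s)).
      + apply filter_imp with (2 := HVf). intros s E. now rewrite E.
      + apply ex_derive_mult; [eexists; exact Hk|exact HD]. }
  split.
  + rewrite (proj1 (HV alpha _ t Ht)), (proj1 (HV (alpha + mu) f t Ht)),
      (proj1 (HV (alpha + mu) (Derive f) t Ht)), Hiff.
    split; [intros H; split; [now apply Hf|exact H]|now intros [_ H]].
  + intros Hex. apply (HV alpha _ t Ht) in Hex.
    assert (HD := proj1 Hiff Hex).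
    rewrite (proj2 (HV alpha _ t Ht) Hex), (proj2 (HV (alpha + mu) f t Ht) (Hf t Ht)),
      (proj2 (HV (alpha + mu) (Derive f) t Ht) HD).
    rewrite (Derive_ext_loc _ _ _ HVf), Derive_mult
      by (solve [eexists; exact Hk | exact HD]).
    rewrite (is_derive_unique _ _ _ Hk), Ewc. unfold k.
    (* The left side is [c * t^(1 - alpha) * (k' * f' + k * f'')] at [t]. These identities extract
       [t^(1 - (alpha + mu))] from both terms and leave a factor [t] in the second; of the two
       factors [c], one is the constant in front and the other belongs to the derivatives of order
       [alpha + mu]. *)
    assert (E1 : Rpower t (1 - alpha) * Rpower t (- mu) = Rpower t (1 - (alpha + mu))).
    { rewrite <- Rpower_plus. f_equal. ring. }
    assert (E2 : Rpower t (1 - mu) = t * Rpower t (- mu)).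
    { rewrite <- (Rpower_1 t) at 2 by assumption.
      rewrite <- Rpower_plus. f_equal. }
    rewrite <- E1, E2.
    rewrite <- RtoC_minus, <- !RtoC_mult, <- RtoC_plus, <- RtoC_mult.
    f_equal. ring.
Qed.
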